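(* Let $\mathcal{B}$ be a category, let $X:\mathcal{B}\to\mathcal{G}$ be a grading of $\mathcal{B}$, and let $x_0$ be an object of $\mathcal{G}$. The quotient category $\left(\mathcal{B}\#_{x_0}X\right)/{}_{x_0}\mathcal{G}_{x_0}$ is canonically isomorphic to $\mathcal{B}$. If $X$ is effective, then the canonical functor $F_X:\mathcal{B}\#_{x_0}X\to\mathcal{B}$ is a Galois covering of $\mathcal{B}$ with $\mathbf{Aut}\left(F_X\right)={}_{x_0}\mathcal{G}_{x_0}$.
   Context: All categories (and groupoids) are small. A groupoid is a category in which all morphisms are invertible. A category is connected if its underlying undirected graph has one connected component. The set of morphisms from $x$ to $y$ in a category $\mathcal{A}$ is denoted ${}_y\mathcal{A}_x$. Fundamental groupoid: $Q\mathcal{B}$ is the category of fractions obtained from $\mathcal{B}$ by formally inverting all morphisms: a groupoid with the same objects as $\mathcal{B}$, with a canonical functor $Q_{\mathcal{B}}:\mathcal{B}\to Q\mathcal{B}$, the identity on objects, such that any functor $F:\mathcal{B}\to\mathcal{C}$ sending every morphism to an invertible morphism factors uniquely as $F=F'Q_{\mathcal{B}}$. A grading of $\mathcal{B}$ is a functor $X:\mathcal{B}\to\mathcal{G}$ to a groupoid $\mathcal{G}$; $QX:Q\mathcal{B}\to\mathcal{G}$ denotes the unique functor with $(QX)Q_{\mathcal{B}}=X$. The grading $X$ is effective if $\mathcal{G}$ is connected, $X$ is bijective on objects, and $QX$ is full. Smash product: for an object $x_0$ of $\mathcal{G}$, the category $\mathcal{B}\#_{x_0}X$ has as objects the pairs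 $(b,\gamma)$ with $b$ an object of $\mathcal{B}$ and $\gamma\in{}_{x_0}\mathcal{G}_{Xb}$; a morphism from $(b,\gamma)$ to $(c,\delta)$ is a morphism $f\in{}_c\mathcal{B}_b$ with $\delta X(f)=\gamma$; composition is that of $\mathcal{B}$. The canonical functor $F_X:\mathcal{B}\#_{x_0}X\to\mathcal{B}$ sends $(b,\gamma)$ to $b$ and a morphism $f$ to $f$. The group ${}_{x_0}\mathcal{G}_{x_0}$ acts on $\mathcal{B}\#_{x_0}X$, freely on objects, by $\alpha(b,\gamma)=(b,\alpha\gamma)$ and $\alpha f=f$, that is, by sending a morphism $f:(b,\gamma)\to(c,\delta)$ to $f:(b,\alpha\gamma)\to(c,\alpha\delta)$. Quotient (orbit) category: if a group $\Gamma$ acts on a category $\mathcal{C}$, freely on objects, $\mathcal{C}/\Gamma$ has as objects the $\Gamma$-orbits of objects, and as morphisms from an orbit $\omega$ to an orbit $\omega'$ the $\Gamma$-orbits of $\coprod_{x\in\omega,\,y\in\omega'}{}_y\mathcal{C}_x$, with the induced composition. Coverings: the source star (resp. target star) at an object is the set of morphisms with that source (resp. target); the star is the disjoint union of both. A functor $F:\mathcal{C}\to\mathcal{B}$ is a covering if it is surjective on objects and, for each object $c$ of $\mathcal{C}$, induces a bijection from the star at $c$ to the star at $Fc$ (equivalently, bijections between corresponding source stars and between corresponding target stars). $\mathbf{Aut}\,F$ is the group of invertible functors $H:\mathcal{C}\to\mathcal{C}$ with $FH=F$. A covering $F$ is a Galois covering if $\mathcal{C}$ is connected and $\mathbf{Aut}\,F$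 acts transitively on the objects of some (equivalently any) fibre of $F$.
   Formalization: The first assertion additionally assumes that every object b has a morphism from Xb to x_0 in G (automatic for connected G); without it the claim fails, e.g. for B = G discrete on two objects and X the identity. *)

(* Defs.v *)
From HB Require Import structures.
From mathcomp Require Import all_boot.
From mathcomp Require Import boolp classical_sets.
From Stdlib Require Import Relation_Operators.

Set Implicit Arguments.
Unset Strict Implicit.
Unset Printing Implicit Defensive.

Declare Scope cat_scope.
Delimit Scope cat_scope with cat.
Local Open Scope group_scope.
Local Open Scope classical_set_scope.
Local Open Scope cat_scope.

(* [hom x y] is the set of morphisms from [x] to [y], i.e. ${}_y C_x$, and
   [compm g f] is [g] after [f]. *)
Record category := Category {
  ob :> Type;
  hom : ob -> ob -> Type;
  idm : forall x, hom x x;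
  compm : forall x y z, hom y z -> hom x y -> hom x z;
  comp1m : forall x y (f : hom x y), compm (idm y) f = f;
  compm1 : forall x y (f : hom x y), compm f (idm x) = f;
  compmA : forall x y z t (h : hom z t) (g : hom y z) (f : hom x y),
    compm h (compm g f) = compm (compm h g) f }.

Arguments hom {c} x y.
Arguments idm {c} x.
Arguments compm {c x y z} g f.
Notation "g \c f" := (compm g f) (at level 40, left associativity) : cat_scope.

Record functor (C D : category) := Functor {
  fob :> C -> D;
  fmap : forall x y : C, hom x y -> hom (fob x) (fob y);
  fmap1 : forall x, fmap (idm x) = idm (fob x);
  fmapM : forall (x y z : C) (g : hom y z) (f : hom x y),
    fmap (g \c f) = fmap g \c fmap f }.

Arguments fmap {C D} F {x y} f : rename.

Definition idF (C : category) : functor C C :=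
  @Functor C C id (fun _ _ f => f) (fun _ => erefl) (fun _ _ _ _ _ => erefl).

Section FunctorComposition.
Variables (C D E : category) (G : functor D E) (F : functor C D).

Fact comp_fmap1 (x : C) : fmap G (fmap F (idm x)) = idm (G (F x)).
Proof. by rewrite !fmap1. Qed.

Fact comp_fmapM (x y z : C) (g : hom y z) (f : hom x y) :
  fmap G (fmap F (g \c f)) = fmap G (fmap F g) \c fmap G (fmap F f).
Proof. by rewrite !fmapM. Qed.

Definition compF : functor C E :=
  @Functor C E (fun x => G (F x)) (fun _ _ f => fmap G (fmap F f))
    comp_fmap1 comp_fmapM.
End FunctorComposition.

Notation "G \F F" := (compF G F) (at level 40, left associativity) : cat_scope.

Definition arrow (C : category) := {x : C & {y : C & hom x y}}.

Definition mk_arrow (C : category) (x y : C) (f : hom x y) : arrow C :=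
  existT _ x (existT _ y f).

Definition src (C : category) (m : arrow C) : C := projT1 m.
Definition tgt (C : category) (m : arrow C) : C := projT1 (projT2 m).

Lemma sval_eq (T : Type) (P : T -> Prop) (s t : {x | P x}) :
  sval s = sval t -> s = t.
Proof. by case: s t => [s ps] [t pt] /= e; apply: eq_exist. Qed.

Lemma existT_inj (T : Type) (P : T -> Type) (x : T) (p q : P x) :
  existT P x p = existT P x q -> p = q.
Proof.
move=> e; have := projT2_eq e => /= <-.
by rewrite (Prop_irrelevance (projT1_eq e) erefl).
Qed.

Lemma mk_arrow_inj (C : category) (x y : C) (f g : hom x y) :
  mk_arrow f = mk_arrow g -> f = g.
Proof. by move=> e; apply: existT_inj (existT_inj e). Qed.

Lemma functor_eq (C D : category) (F G : functor C D) :
  (forall (x y : C) (f : hom x y), mk_arrow (fmap F f) = mk_arrow (fmap G f)) ->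
  F = G.
Proof.
case: F G => [Fo Fm F1 FM] [Go Gm G1 GM] /= FG.
have e : Fo = Go by apply: funext => x; have := FG _ _ (idm x); case.
subst Go; have e : Fm = Gm.
  by do 3!apply: functional_extensionality_dep => ?; apply: mk_arrow_inj.
by subst Gm; congr Functor; apply: Prop_irrelevance.
Qed.

Lemma compFA (C1 C2 C3 C4 : category) (H : functor C3 C4) (G : functor C2 C3)
  (F : functor C1 C2) : H \F (G \F F) = (H \F G) \F F.
Proof. exact: functor_eq. Qed.

Lemma comp1F (C D : category) (F : functor C D) : idF D \F F = F.
Proof. exact: functor_eq. Qed.

Lemma compF1 (C D : category) (F : functor C D) : F \F idF C = F.
Proof. exact: functor_eq. Qed.

Definition is_isomorphism (C D : category) (F : functor C D) :=
  exists G : functor D C, G \F F = idF C /\ F \F G = idF D.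

Definition full (C D : category) (F : functor C D) :=
  forall (x y : C) (g : hom (F x) (F y)), exists f : hom x y, fmap F f = g.

(* Exactly one connected component, so [C] is nonempty. *)
Definition connected (C : category) :=
  inhabited C /\
  forall x y : C, clos_refl_sym_trans C
    (fun x y => inhabited (hom x y)) x y.

Definition invertible (C : category) (x y : C) (f : hom x y) :=
  exists g : hom y x, g \c f = idm x /\ f \c g = idm y.

Record groupoid := Groupoid {
  gcat :> category;
  ginvertible : forall (x y : gcat) (f : hom x y), invertible f }.

Section Inverse.
Variables (C : category) (x y : C) (f : hom x y) (fV : invertible f).

Definition invm : hom y x := sval (cid fV).

Lemma compVm : invm \c f = idm x. Proof. by case: (svalP (cid fV)). Qed.
Lemma compmV : f \c invm = idm y. Proof. by case: (svalP (cid fV)). Qed.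

Lemma invm_unique (g : hom y x) : f \c g = idm y -> g = invm.
Proof. by move=> fg; rewrite -[g]comp1m -compVm -compmA fg compm1. Qed.
End Inverse.

Definition ginv (G : groupoid) (x y : G) (f : hom x y) : hom y x :=
  invm (ginvertible f).

(* The localization at all morphisms: [QHom x y] is the set of equivalence
   classes of formal composites of morphisms of [B] and formal inverses of
   morphisms of [B], modulo the congruence [zrel] imposing the axioms of a
   category, the functoriality of [B -> QB] and the invertibility of the image
   of each morphism.  [Q_universal] is the universal property. *)

Section FundamentalGroupoid.
Variable B : category.

Inductive zterm : B -> B -> Type :=
| zgen x y of hom x y : zterm x y
| zinv x y of hom x y : zterm y x
| zid x : zterm x x
| zcomp x y z of zterm y z & zterm x y : zterm x z.

Inductive zrel : forall x y, zterm x y -> zterm x y -> Prop :=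
| zrel_refl x y (p : zterm x y) : zrel p p
| zrel_sym x y (p q : zterm x y) of zrel p q : zrel q p
| zrel_trans x y (p q r : zterm x y) of zrel p q & zrel q r : zrel p r
| zrel_comp x y z (p p' : zterm y z) (q q' : zterm x y)
    of zrel p p' & zrel q q' : zrel (zcomp p q) (zcomp p' q')
| zrel_1c x y (p : zterm x y) : zrel (zcomp (zid y) p) p
| zrel_c1 x y (p : zterm x y) : zrel (zcomp p (zid x)) p
| zrel_cA x y z t (p : zterm z t) (q : zterm y z) (r : zterm x y) :
    zrel (zcomp p (zcomp q r)) (zcomp (zcomp p q) r)
| zrel_gen1 x : zrel (zgen (idm x)) (zid x)
| zrel_genM x y z (g : hom y z) (f : hom x y) :
    zrel (zgen (g \c f)) (zcomp (zgen g) (zgen f))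
| zrel_Vc x y (f : hom x y) : zrel (zcomp (zinv f) (zgen f)) (zid x)
| zrel_cV x y (f : hom x y) : zrel (zcomp (zgen f) (zinv f)) (zid y).

Definition QHom (x y : B) :=
  {P : set (zterm x y) | exists p, P = [set q | zrel p q]}.

Definition zclass (x y : B) (p : zterm x y) : QHom x y :=
  exist _ [set q | zrel p q] (ex_intro _ p erefl).

Definition zrepr (x y : B) (c : QHom x y) : zterm x y := sval (cid (svalP c)).

Lemma zclass_eq (x y : B) (p q : zterm x y) : zrel p q -> zclass p = zclass q.
Proof.
move=> pq; apply: sval_eq; apply/seteqP; split=> r /= pr.
  exact: zrel_trans (zrel_sym pq) pr.
exact: zrel_trans pq pr.
Qed.

Lemma zreprK (x y : B) (c : QHom x y) : zclass (zrepr c) = c.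
Proof.
by apply: sval_eq; rewrite /zrepr; case: (cid _).
Qed.

Lemma zclassK (x y : B) (p : zterm x y) : zrel (zrepr (zclass p)) p.
Proof.
have := congr1 sval (zreprK (zclass p)) => /= /seteqP[_]; apply.
exact: zrel_refl.
Qed.

Definition Qcomp (x y z : B) (c : QHom y z) (d : QHom x y) : QHom x z :=
  zclass (zcomp (zrepr c) (zrepr d)).

Lemma QcompE (x y z : B) (p : zterm y z) (q : zterm x y) :
  Qcomp (zclass p) (zclass q) = zclass (zcomp p q).
Proof. by apply: zclass_eq; apply: zrel_comp; apply: zclassK. Qed.

Fact Qcomp1m (x y : B) (c : QHom x y) : Qcomp (zclass (zid y)) c = c.
Proof.
by rewrite -[c]zreprK QcompE; apply: zclass_eq; apply: zrel_1c.
Qed.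

Fact Qcompm1 (x y : B) (c : QHom x y) : Qcomp c (zclass (zid x)) = c.
Proof.
by rewrite -[c]zreprK QcompE; apply: zclass_eq; apply: zrel_c1.
Qed.

Fact QcompA (x y z t : B) (c : QHom z t) (d : QHom y z) (e : QHom x y) :
  Qcomp c (Qcomp d e) = Qcomp (Qcomp c d) e.
Proof.
rewrite -[c]zreprK -[d]zreprK -[e]zreprK !QcompE.
by apply: zclass_eq; apply: zrel_cA.
Qed.

Definition Qcat : category :=
  @Category B QHom (fun x => zclass (zid x)) Qcomp Qcomp1m Qcompm1 QcompA.

Fact Qinvertible (x y : Qcat) (c : hom x y) : invertible c.
Proof.
rewrite -[c]zreprK; elim: (zrepr c) => {c x y}
    [x y f|x y f|x|x y z p [p' [pl pr]] q [q' [ql qr]]].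
- exists (zclass (zinv f)); rewrite /= !QcompE.
  by split; apply: zclass_eq; [apply: zrel_Vc|apply: zrel_cV].
- exists (zclass (zgen f)); rewrite /= !QcompE.
  by split; apply: zclass_eq; [apply: zrel_cV|apply: zrel_Vc].
- by exists (idm (x : Qcat)); rewrite comp1m.
- rewrite -QcompE -/(compm (c := Qcat) (zclass p) (zclass q)).
  exists (q' \c p'); split.
    by rewrite -compmA (compmA p') pl comp1m.
  by rewrite -compmA (compmA _ q') qr comp1m.
Qed.

Definition Q : groupoid := Groupoid Qinvertible.

Fact Qfmap1 (x : B) : zclass (zgen (idm x)) = zclass (zid x).
Proof. by apply: zclass_eq; apply: zrel_gen1. Qed.

Fact QfmapM (x y z : B) (g : hom y z) (f : hom x y) :
  zclass (zgen (g \c f)) = Qcomp (zclass (zgen g)) (zclass (zgen f)).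
Proof. by rewrite QcompE; apply: zclass_eq; apply: zrel_genM. Qed.

Definition Qfun : functor B Q :=
  @Functor B Q id (fun x y f => zclass (zgen f)) Qfmap1 QfmapM.

Section Lift.
Variables (C : category) (F : functor B C).
Hypothesis FV : forall (x y : B) (f : hom x y), invertible (fmap F f).

Fixpoint zeval (x y : B) (p : zterm x y) : hom (F x) (F y) :=
  match p with
  | zgen _ _ f => fmap F f
  | zinv _ _ f => invm (FV f)
  | zid x => idm (F x)
  | zcomp _ _ _ p q => zeval p \c zeval q
  end.

Lemma zeval_rel (x y : B) (p q : zterm x y) : zrel p q -> zeval p = zeval q.
Proof.
elim=> //= {x y p q}.
- by move=> x y p q r _ -> _.
- by move=> x y z p p' q q' _ -> _ ->.
- by move=> *; rewrite comp1m.
- by move=> *; rewrite compm1.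
- by move=> *; rewrite compmA.
- by move=> *; rewrite fmap1.
- by move=> *; rewrite fmapM.
- by move=> *; rewrite compVm.
- by move=> *; rewrite compmV.
Qed.

Fact lift_fmap1 (x : B) : zeval (zrepr (zclass (zid x))) = idm (F x).
Proof. exact: zeval_rel (zclassK _). Qed.

Fact lift_fmapM (x y z : B) (c : QHom y z) (d : QHom x y) :
  zeval (zrepr (Qcomp c d)) = zeval (zrepr c) \c zeval (zrepr d).
Proof. exact: zeval_rel (zclassK _). Qed.

Definition Qlift : functor Q C :=
  @Functor Q C F (fun x y c => zeval (zrepr c)) lift_fmap1 lift_fmapM.

Lemma Qlift_comm : Qlift \F Qfun = F.
Proof.
apply: functor_eq => x y f; congr mk_arrow.
exact: zeval_rel (zclassK (zgen f)).
Qed.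

Lemma Q_universal : exists! F' : functor Q C, F' \F Qfun = F.
Proof.
exists Qlift; split=> [|F' e]; first exact: Qlift_comm.
apply: functor_eq => x y c; rewrite -[c]zreprK.
have E (a b : B) (f : hom a b) :
    mk_arrow (fmap Qlift (zclass (zgen f))) =
    mk_arrow (fmap F' (zclass (zgen f))).
  rewrite -[LHS]/(mk_arrow (fmap (Qlift \F Qfun) f)).
  by rewrite -[RHS]/(mk_arrow (fmap (F' \F Qfun) f)) Qlift_comm e.
have e0 : fob Qlift = fob F'.
  by apply: funext => a; have := E _ _ (@idm B a); case.
case: F' {e} E e0 => Fo Fm F1 FM /= E e0; subst Fo.
congr mk_arrow; elim: (zrepr c) => {c x y} [x y f|x y f|x|x y z p ihp q ihq].
- exact: mk_arrow_inj (E _ _ f).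
- have e : Fm _ _ (zclass (zgen f)) = fmap F f.
    rewrite -(mk_arrow_inj (E _ _ f)); exact: zeval_rel (zclassK _).
  rewrite [LHS](zeval_rel (zclassK _)) /=; apply/esym/invm_unique.
  rewrite -e -FM -F1 /=; congr (Fm _ _ _).
  by rewrite QcompE; apply/zclass_eq/zrel_cV.
- by rewrite F1; exact: zeval_rel (zclassK _).
- by rewrite -QcompE FM -ihp -ihq lift_fmapM.
Qed.
End Lift.
End FundamentalGroupoid.

Arguments Qlift {B C} F FV.

Notation grading B G := (functor B (gcat G)).

Definition Qgrading (B : category) (G : groupoid) (X : grading B G) :
  functor (Q B) G := Qlift X (fun _ _ f => ginvertible (fmap X f)).

Definition effective (B : category) (G : groupoid) (X : grading B G) :=
  [/\ connected G, bijective (fob X) & full (Qgrading X)].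

Definition vertex_group (G : groupoid) (x : G) : Type := hom x x.

Section VertexGroup.
Variables (G : groupoid) (x : G).

HB.instance Definition _ := gen_eqMixin (vertex_group x).
HB.instance Definition _ := gen_choiceMixin (vertex_group x).

Definition vmul (a b : vertex_group x) : vertex_group x := compm (c := G) a b.
Definition vinv (a : vertex_group x) : vertex_group x := ginv (G := G) a.
Definition vone : vertex_group x := @idm G x.

Fact vmulA : associative vmul. Proof. by move=> a b c; apply: compmA. Qed.
Fact vmul1g : left_id vone vmul. Proof. by move=> a; apply: comp1m. Qed.
Fact vmulg1 : right_id vone vmul. Proof. by move=> a; apply: compm1. Qed.
Fact vmulVg : left_inverse vone vinv vmul.
Proof. by move=> a; apply: compVm. Qed.
Fact vmulgV : right_inverse vone vinv vmul.
Proof. by move=> a; apply: compmV. Qed.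

HB.instance Definition _ :=
  isGroup.Build (vertex_group x) vmulA vmul1g vmulg1 vmulVg vmulgV.
End VertexGroup.

Section Smash.
Variables (B : category) (G : groupoid) (X : grading B G) (x0 : G).

(* Only the objects [b] such that [X b] lies in the connected component of [x0]
   occur here. *)
Definition smash_ob := {b : B & hom (X b) x0}.

Definition smash_hom (s t : smash_ob) :=
  {f : hom (projT1 s) (projT1 t) | projT2 t \c fmap X f = projT2 s}.

Fact smash_id_subproof (s : smash_ob) :
  projT2 s \c fmap X (idm (projT1 s)) = projT2 s.
Proof. by rewrite fmap1 compm1. Qed.

Fact smash_comp_subproof (s t u : smash_ob) (g : smash_hom t u)
  (f : smash_hom s t) : projT2 u \c fmap X (sval g \c sval f) = projT2 s.
Proof. by rewrite fmapM compmA (svalP g) (svalP f). Qed.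

Definition smash_id (s : smash_ob) : smash_hom s s :=
  exist _ (idm (projT1 s)) (smash_id_subproof s).

Definition smash_comp (s t u : smash_ob) (g : smash_hom t u)
  (f : smash_hom s t) : smash_hom s u :=
  exist _ (sval g \c sval f) (smash_comp_subproof g f).

Fact smash_comp1m (s t : smash_ob) (f : smash_hom s t) :
  smash_comp (smash_id t) f = f.
Proof. by case: f => f Hf; apply: sval_eq; apply: comp1m. Qed.

Fact smash_compm1 (s t : smash_ob) (f : smash_hom s t) :
  smash_comp f (smash_id s) = f.
Proof. by case: f => f Hf; apply: sval_eq; apply: compm1. Qed.

Fact smash_compmA (s t u v : smash_ob) (h : smash_hom u v) (g : smash_hom t u)
  (f : smash_hom s t) :
  smash_comp h (smash_comp g f) = smash_comp (smash_comp h g) f.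
Proof. by apply: sval_eq; apply: compmA. Qed.

Definition smash : category :=
  Category smash_comp1m smash_compm1 smash_compmA.

Definition smash_proj : functor smash B :=
  @Functor smash B (@projT1 _ _) (fun _ _ f => sval f)
    (fun _ => erefl) (fun _ _ _ _ _ => erefl).
End Smash.

Record action (Gamma : groupType) (C : category) := Action {
  act :> Gamma -> functor C C;
  act1 : act 1 = idF C;
  actM : forall a b, act (a * b) = act a \F act b }.

Definition free_on_objects (Gamma : groupType) (C : category)
  (A : action Gamma C) := forall a (x : C), A a x = x -> a = 1.

Section OrbitCategory.
Variables (Gamma : groupType) (C : category) (A : action Gamma C).

Definition act_arrow (a : Gamma) (m : arrow C) : arrow C :=
  mk_arrow (fmap (A a) (projT2 (projT2 m))).

Definition orbit_of (x : C) : set C := range (fun a => A a x).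

Definition arrow_orbit (m : arrow C) : set (arrow C) :=
  range (fun a => act_arrow a m).

Definition orbit_ob := {w : set C | exists x, w = orbit_of x}.

Definition orbit_hom (w w' : orbit_ob) :=
  {S : set (arrow C) | exists m,
     [/\ sval w (src m), sval w' (tgt m) & S = arrow_orbit m]}.

Lemma actK (a : Gamma) (x : C) : A a^-1 (A a x) = x.
Proof. by rewrite -[LHS]/((A a^-1 \F A a) x) -actM mulVg act1. Qed.

Lemma act_arrow1 (m : arrow C) : act_arrow 1 m = m.
Proof. by case: m => x [y f]; rewrite /act_arrow act1. Qed.

Lemma act_arrowM (a b : Gamma) (m : arrow C) :
  act_arrow (a * b) m = act_arrow a (act_arrow b m).
Proof. by case: m => x [y f]; rewrite /act_arrow actM. Qed.

Lemma orbit_self (x : C) : orbit_of x x.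
Proof. by exists 1; rewrite // act1. Qed.

Lemma arrow_orbit_self (m : arrow C) : arrow_orbit m m.
Proof. by exists 1; rewrite // act_arrow1. Qed.

Lemma arrow_orbit_act (a : Gamma) (m : arrow C) :
  arrow_orbit (act_arrow a m) = arrow_orbit m.
Proof.
apply/seteqP; split=> _ [b _ <-]; first by exists (b * a); rewrite ?act_arrowM.
by exists (b * a^-1); rewrite // -act_arrowM mulgVK.
Qed.

Lemma orbit_trans (w : orbit_ob) (x y : C) :
  sval w x -> sval w y -> exists a, A a x = y.
Proof.
have [z ->] := svalP w => -[a _ <-] [b _ <-]; exists (b * a^-1).
by rewrite actM /= actK.
Qed.

Lemma orbit_act (w : orbit_ob) (a : Gamma) (x : C) :
  sval w x -> sval w (A a x).
Proof.
by have [z ->] := svalP w => -[b _ <-]; exists (a * b); rewrite // actM.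
Qed.

Definition orbit_id_set (w : orbit_ob) : set (arrow C) :=
  [set m | exists2 x, sval w x & m = mk_arrow (idm x)].

(* The composites of all composable pairs of representatives; since the action
   is free on objects they form a single orbit, see [orbit_comp_setE]. *)
Definition orbit_comp_set (T S : set (arrow C)) : set (arrow C) :=
  [set m | exists x y z (g : hom y z) (f : hom x y),
     [/\ T (mk_arrow g), S (mk_arrow f) & m = mk_arrow (g \c f)]].

Fact orbit_id_subproof (w : orbit_ob) : exists m,
  [/\ sval w (src m), sval w (tgt m) & orbit_id_set w = arrow_orbit m].
Proof.
have [x wx] : exists x, sval w x.
  by have [x ->] := svalP w; exists x; apply: orbit_self.
exists (mk_arrow (idm x)); split=> //; apply/seteqP; split=> [_ [y wy ->]|].
  have [a <-] := orbit_trans wx wy.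
  by exists a => //; rewrite /act_arrow /= fmap1.
move=> _ [a _ <-]; exists (A a x); first exact: orbit_act.
by rewrite /act_arrow /= fmap1.
Qed.

Definition orbit_id (w : orbit_ob) : orbit_hom w w :=
  exist _ (orbit_id_set w) (orbit_id_subproof w).

Hypothesis Afree : free_on_objects A.

Lemma free_inj (a b : Gamma) (x : C) : A a x = A b x -> a = b.
Proof.
move=> e; apply: (mulgI b^-1); rewrite mulVg; apply: (Afree (x := x)).
by rewrite actM /= e actK.
Qed.

Lemma orbit_comp_setE (x y z : C) (g : hom y z) (f : hom x y) :
  orbit_comp_set (arrow_orbit (mk_arrow g)) (arrow_orbit (mk_arrow f)) =
  arrow_orbit (mk_arrow (g \c f)).
Proof.
apply/seteqP; split=> [_ [x' [y' [z' [g' [f' [[a _ eg] [b _ ef] ->]]]]]]|].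
  have eab : b = a.
    apply: (@free_inj _ _ y); move: (congr1 (@src C) eg) (congr1 (@tgt C) ef).
    by rewrite /src /tgt /= => -> ->.
  subst b; case: (ef) => ? ?; case: (eg) => _ ?; subst x' y' z'.
  exists a => //; rewrite /act_arrow /= fmapM.
  by rewrite (mk_arrow_inj ef) (mk_arrow_inj eg).
move=> _ [a _ <-]; exists (A a x), (A a y), (A a z), (fmap (A a) g),
  (fmap (A a) f); split; try by exists a.
by rewrite /act_arrow /= fmapM.
Qed.

Lemma orbit_comp_rep (w1 w2 w3 : orbit_ob) (T : orbit_hom w2 w3)
    (S : orbit_hom w1 w2) :
  exists x y z (g : hom y z) (f : hom x y),
  [/\ sval w1 x, sval w2 y, sval w3 z,
      sval T = arrow_orbit (mk_arrow g) & sval S = arrow_orbit (mk_arrow f)].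
Proof.
have [[y' [z g]] [/= w2y' w3z ->]] := svalP T.
have [[x [y f]] [/= w1x w2y ->]] := svalP S.
have [a ay] := orbit_trans w2y w2y'.
rewrite /src /tgt /= in w2y' w3z w1x w2y ay; subst y'.
exists (A a x), (A a y), z, g, (fmap (A a) f); split=> //.
  exact: orbit_act.
by rewrite -(arrow_orbit_act a).
Qed.

Fact orbit_comp_subproof (w1 w2 w3 : orbit_ob) (T : orbit_hom w2 w3)
    (S : orbit_hom w1 w2) : exists m,
  [/\ sval w1 (src m), sval w3 (tgt m) &
      orbit_comp_set (sval T) (sval S) = arrow_orbit m].
Proof.
have [x [y [z [g [f [w1x _ w3z -> ->]]]]]] := orbit_comp_rep T S.
by exists (mk_arrow (g \c f)); split; rewrite // orbit_comp_setE.
Qed.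

Definition orbit_comp (w1 w2 w3 : orbit_ob) (T : orbit_hom w2 w3)
    (S : orbit_hom w1 w2) : orbit_hom w1 w3 :=
  exist _ (orbit_comp_set (sval T) (sval S)) (orbit_comp_subproof T S).

Fact orbit_comp1m (w w' : orbit_ob) (S : orbit_hom w w') :
  orbit_comp (orbit_id w') S = S.
Proof.
case: S => S HS; apply: sval_eq; case: HS => [[x [y f]] [/= wx wy eS]].
apply/seteqP; split=> m /=.
  move=> [x1 [y1 [z1 [g1 [f1 [[z _ eg] Sf ->]]]]]].
  case: (eg) => ? ?; subst y1 z1.
  by rewrite (mk_arrow_inj eg) comp1m.
move=> Sm; case: m Sm => x1 [y1 f1] Sm.
exists x1, y1, y1, (idm y1), f1; split=> //; last by rewrite comp1m.
exists y1 => //; move: Sm; rewrite eS => -[a _] e.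
by rewrite -(congr1 (@tgt C) e : A a y = y1); apply: orbit_act.
Qed.

Fact orbit_compm1 (w w' : orbit_ob) (S : orbit_hom w w') :
  orbit_comp S (orbit_id w) = S.
Proof.
case: S => S HS; apply: sval_eq; case: HS => [[x [y f]] [/= wx wy eS]].
apply/seteqP; split=> m /=.
  move=> [x1 [y1 [z1 [g1 [f1 [Sg [z _ ef] ->]]]]]].
  case: (ef) => ? ?; subst x1 y1.
  by rewrite (mk_arrow_inj ef) compm1.
move=> Sm; case: m Sm => x1 [y1 f1] Sm.
exists x1, x1, y1, f1, (idm x1); split=> //; last by rewrite compm1.
exists x1 => //; move: Sm; rewrite eS => -[a _] e.
by rewrite -(congr1 (@src C) e : A a x = x1); apply: orbit_act.
Qed.

Fact orbit_compmA (w1 w2 w3 w4 : orbit_ob) (U : orbit_hom w3 w4)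
    (T : orbit_hom w2 w3) (S : orbit_hom w1 w2) :
  orbit_comp U (orbit_comp T S) = orbit_comp (orbit_comp U T) S.
Proof.
apply: sval_eq; apply/seteqP; split=> m /=.
  move=> [x [z [t [h [k [Uh [x' [y [z' [g [f [Tg Sf e]]]]]] ->]]]]]].
  case: (e) => ? ?; subst x' z'; rewrite (mk_arrow_inj e).
  exists x, y, t, (h \c g), f; split=> //; last by rewrite compmA.
  by exists y, z, t, h, g.
move=> [x [y [t [k [f [[y' [z [t' [h [g [Uh Tg e]]]]]] Sf ->]]]]]].
case: (e) => ? ?; subst y' t'; rewrite (mk_arrow_inj e).
exists x, z, t, h, (g \c f); split=> //; last by rewrite compmA.
by exists x, y, z, g, f.
Qed.

Definition orbit_cat : category :=
  Category orbit_comp1m orbit_compm1 orbit_compmA.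

Definition orbit_proj_ob (x : C) : orbit_ob :=
  exist _ (orbit_of x) (ex_intro _ x erefl).

Fact orbit_proj_subproof (x y : C) (f : hom x y) : exists m,
  [/\ sval (orbit_proj_ob x) (src m), sval (orbit_proj_ob y) (tgt m) &
      arrow_orbit (mk_arrow f) = arrow_orbit m].
Proof. by exists (mk_arrow f); split=> //; apply: orbit_self. Qed.

Definition orbit_proj_hom (x y : C) (f : hom x y) :
    orbit_hom (orbit_proj_ob x) (orbit_proj_ob y) :=
  exist _ (arrow_orbit (mk_arrow f)) (orbit_proj_subproof f).

Fact orbit_proj1 (x : C) : orbit_proj_hom (idm x) = orbit_id (orbit_proj_ob x).
Proof.
apply: sval_eq; apply/seteqP; split=> [_ [a _ <-]|_ [_ [a _ <-] ->]].
  by exists (A a x); [exists a|rewrite /act_arrow /= fmap1].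
by exists a => //; rewrite /act_arrow /= fmap1.
Qed.

Fact orbit_projM (x y z : C) (g : hom y z) (f : hom x y) :
  orbit_proj_hom (g \c f) = orbit_comp (orbit_proj_hom g) (orbit_proj_hom f).
Proof. by apply: sval_eq; rewrite /= orbit_comp_setE. Qed.

Definition orbit_proj : functor C orbit_cat :=
  @Functor C orbit_cat orbit_proj_ob orbit_proj_hom orbit_proj1 orbit_projM.
End OrbitCategory.

Arguments orbit_cat {Gamma C A} Afree.
Arguments orbit_proj {Gamma C A} Afree.

Section SmashAction.
Variables (B : category) (G : groupoid) (X : grading B G) (x0 : G).
Local Notation Gamma := (vertex_group x0).
Local Notation BX := (smash X x0).

Definition smash_act_ob (a : Gamma) (s : BX) : BX :=
  existT _ (projT1 s) (compm (c := G) a (projT2 s)).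

Fact smash_act_subproof (a : Gamma) (s t : BX) (f : hom s t) :
  projT2 (smash_act_ob a t) \c fmap X (sval f) = projT2 (smash_act_ob a s).
Proof. by rewrite /= -compmA (svalP f). Qed.

Definition smash_act_hom (a : Gamma) (s t : BX) (f : hom s t) :
    hom (smash_act_ob a s) (smash_act_ob a t) :=
  exist _ (sval f) (smash_act_subproof a f).

Fact smash_act_hom1 (a : Gamma) (s : BX) :
  smash_act_hom a (idm s) = idm (smash_act_ob a s).
Proof. exact: sval_eq. Qed.

Fact smash_act_homM (a : Gamma) (s t u : BX) (g : hom t u) (f : hom s t) :
  smash_act_hom a (g \c f) = smash_act_hom a g \c smash_act_hom a f.
Proof. exact: sval_eq. Qed.

Definition smash_act (a : Gamma) : functor BX BX :=
  @Functor BX BX (smash_act_ob a) (@smash_act_hom a)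
    (smash_act_hom1 a) (smash_act_homM a).

Lemma smash_arrow_eq (b c : B) (f : hom b c) (g g' : hom (X b) x0)
    (d d' : hom (X c) x0) (Hf : d \c fmap X f = g) (Hf' : d' \c fmap X f = g') :
  d = d' ->
  @mk_arrow BX (existT _ b g) (existT _ c d) (exist _ f Hf) =
  @mk_arrow BX (existT _ b g') (existT _ c d') (exist _ f Hf').
Proof. by move=> e; subst. Qed.

Fact smash_act1 : smash_act 1 = idF BX.
Proof.
apply: functor_eq => -[b g] [c d] [f Hf].
by apply: smash_arrow_eq; apply: comp1m.
Qed.

Fact smash_actM (a b : Gamma) : smash_act (a * b) = smash_act a \F smash_act b.
Proof.
apply: functor_eq => -[x g] [y d] [f Hf].
by apply: smash_arrow_eq; apply/esym/compmA.
Qed.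

Definition smash_action : action Gamma BX := Action smash_act1 smash_actM.

Lemma smash_action_free : free_on_objects smash_action.
Proof.
move=> a [b g] e0; have /= e := existT_inj e0.
rewrite -[LHS](compm1 (c := G)) -(compmV (ginvertible g)) compmA e.
exact: compmV.
Qed.

Lemma smash_proj_act (a : Gamma) :
  smash_proj X x0 \F smash_action a = smash_proj X x0.
Proof. exact: functor_eq. Qed.
End SmashAction.

Definition source_star (C : category) (c : C) := {y : C & hom c y}.
Definition target_star (C : category) (c : C) := {x : C & hom x c}.
Definition star (C : category) (c : C) := (source_star c + target_star c)%type.

Definition star_map (C B : category) (F : functor C B) (c : C) :
    star c -> star (F c) :=
  fun m => match m with
  | inl s => inl (existT _ (F (projT1 s)) (fmap F (projT2 s)))
  | inr t => inr (existT _ (F (projT1 t)) (fmap F (projT2 t)))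
  end.

Definition is_covering (C B : category) (F : functor C B) :=
  (forall b : B, exists c : C, F c = b) /\
  (forall c : C, bijective (star_map F (c := c))).

Record Aut (C B : category) (F : functor C B) := MkAut {
  aut_fun :> functor C C;
  aut_iso : is_isomorphism aut_fun;
  aut_over : F \F aut_fun = F }.

Lemma aut_eq (C B : category) (F : functor C B) (H K : Aut F) :
  aut_fun H = aut_fun K -> H = K.
Proof.
case: H K => [H H1 H2] [K K1 K2] /= e; subst K.
by congr MkAut; apply: Prop_irrelevance.
Qed.

Section AutGroup.
Variables (C B : category) (F : functor C B).

HB.instance Definition _ := gen_eqMixin (Aut F).
HB.instance Definition _ := gen_choiceMixin (Aut F).

Fact aut_one_iso : is_isomorphism (idF C).
Proof. by exists (idF C); rewrite comp1F. Qed.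

Definition aut_one : Aut F := MkAut aut_one_iso (compF1 F).

Fact aut_mul_iso (H K : Aut F) : is_isomorphism (H \F K).
Proof.
case: (aut_iso H) (aut_iso K) => H' [H1 H2] [K' [K1 K2]].
exists (K' \F H'); split.
  by rewrite -compFA (compFA H') H1 comp1F.
by rewrite -compFA (compFA K) K2 comp1F.
Qed.

Fact aut_mul_over (H K : Aut F) : F \F (H \F K) = F.
Proof. by rewrite compFA !aut_over. Qed.

Definition aut_mul (H K : Aut F) : Aut F :=
  MkAut (aut_mul_iso H K) (aut_mul_over H K).

Definition invF (H : Aut F) : functor C C := sval (cid (aut_iso H)).

Fact invFK (H : Aut F) : invF H \F H = idF C /\ H \F invF H = idF C.
Proof. exact: svalP (cid (aut_iso H)). Qed.

Fact aut_inv_iso (H : Aut F) : is_isomorphism (invF H).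
Proof. by exists H; case: (invFK H). Qed.

Fact aut_inv_over (H : Aut F) : F \F invF H = F.
Proof.
by rewrite -{1}(aut_over H) -compFA; case: (invFK H) => _ ->; rewrite compF1.
Qed.

Definition aut_inv (H : Aut F) : Aut F :=
  MkAut (aut_inv_iso H) (aut_inv_over H).

Fact aut_mulA : associative aut_mul.
Proof. by move=> H K L; apply: aut_eq; apply: compFA. Qed.
Fact aut_mul1g : left_id aut_one aut_mul.
Proof. by move=> H; apply: aut_eq; apply: comp1F. Qed.
Fact aut_mulg1 : right_id aut_one aut_mul.
Proof. by move=> H; apply: aut_eq; apply: compF1. Qed.
Fact aut_mulVg : left_inverse aut_one aut_inv aut_mul.
Proof. by move=> H; apply: aut_eq; case: (invFK H). Qed.
Fact aut_mulgV : right_inverse aut_one aut_inv aut_mul.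
Proof. by move=> H; apply: aut_eq; case: (invFK H). Qed.

HB.instance Definition _ :=
  isGroup.Build (Aut F) aut_mulA aut_mul1g aut_mulg1 aut_mulVg aut_mulgV.
End AutGroup.

Definition is_galois_covering (C B : category) (F : functor C B) :=
  [/\ is_covering F, connected C &
      exists b : B, forall c c' : C, F c = b -> F c' = b ->
        exists H : Aut F, H c = c'].

Section Deck.
Variables (B : category) (G : groupoid) (X : grading B G) (x0 : G).

Fact deck_iso (a : vertex_group x0) : is_isomorphism (smash_action X x0 a).
Proof.
by exists (smash_action X x0 a^-1); rewrite -!actM mulVg mulgV act1.
Qed.

Definition deck (a : vertex_group x0) : Aut (smash_proj X x0) :=
  MkAut (deck_iso a) (smash_proj_act X a).
End Deck.

(* Main.v *)
(* A functor invariant under a group acting freely on objects factors through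
   the orbit category; applied to F_X this gives Phi.  Its inverse sends an
   object or a morphism of B to its fibre under F_X, which is a single orbit.
   Both the orbit projection and F_X hit every arrow, hence are epimorphisms,
   and this yields the uniqueness of Phi and the two inverse laws.

   A morphism f of B lifts uniquely with prescribed source (b, g), the target
   label being g X(f)^-1, and with prescribed target; so F_X is a covering.  When
   X is effective, the element d^-1 g comes from a zigzag of B, whose lift joins
   (b, g) to (c, d); so the smash product is connected.  An automorphism over a
   connected covering is determined by the image of one object, and the vertex
   group is already transitive on fibres. *)
Require Import Defs.
From mathcomp Require Import all_boot.
From mathcomp Require Import boolp classical_sets.
From Stdlib Require Import Relation_Operators.

Set Implicit Arguments.
Unset Strict Implicit.
Unset Printing Implicit Defensive.
Local Open Scope group_scope.
Local Open Scope classical_set_scope.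
Local Open Scope cat_scope.

(** * Functors compared through their action on arrows *)

Definition arrow_map (C D : category) (F : functor C D) (m : arrow C) :
    arrow D :=
  mk_arrow (fmap F (projT2 (projT2 m))).

(** Arrows carry their endpoints, so functors can be compared as plain maps, without transport
    between hom-sets. *)
Lemma functor_eqP (C D : category) (F G : functor C D) :
  F = G <-> arrow_map F = arrow_map G.
Proof.
split=> [->//|FG]; apply: functor_eq => x y f.
exact: (congr1 (fun H => H (mk_arrow f)) FG).
Qed.

Lemma functor_epi (C D E : category) (F : functor C D) (G H : functor D E) :
  (forall n, exists m, arrow_map F m = n) -> G \F F = H \F F -> G = H.
Proof.
move=> surjF /functor_eqP GH; apply/functor_eqP/funext => n.
have [m <-] := surjF n; exact: (congr1 (fun K => K m) GH).
Qed.

Lemma bijective_of_inj_surj (T U : Type) (f : T -> U) :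
  injective f -> (forall u, exists t, f t = u) -> bijective f.
Proof.
move=> injf surjf; pose g u := sval (cid (surjf u)).
have gK : cancel g f by move=> u; apply: svalP (cid (surjf u)).
by exists g => // t; apply/injf/gK.
Qed.

(** * Factoring an invariant functor through the orbit category *)

Section OrbitLift.
Variables (Gamma : groupType) (C D : category) (A : action Gamma C).
Hypothesis Afree : free_on_objects A.

Lemma orbit_ob_eq (w : orbit_ob A) (x : C) :
  sval w x -> w = orbit_proj_ob A x.
Proof.
case: w => w Hw; case: (Hw) => z /= ew wx; apply: sval_eq => /=.
apply/seteqP; split=> [y wy|_ [a _ <-]].
  have [a <-] := @orbit_trans _ _ A (exist _ w Hw) _ _ wx wy.
  by exists a.
exact: (@orbit_act _ _ A (exist _ w Hw)).
Qed.

Lemma orbit_arrow_eq (u u' w w' : orbit_cat Afree) (S : hom u w)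
    (T : hom u' w') :
  u = u' -> w = w' -> sval S = sval T -> mk_arrow S = mk_arrow T.
Proof. by move=> eu ew; subst u' w' => /sval_eq ->. Qed.

Lemma orbit_proj_surj (n : arrow (orbit_cat Afree)) :
  exists m, arrow_map (orbit_proj Afree) m = n.
Proof.
case: n => w [w' [S HS]]; have [[x [y f]] [/= wx wy eS]] := HS.
have e : w = orbit_proj_ob A x := orbit_ob_eq wx.
have e' : w' = orbit_proj_ob A y := orbit_ob_eq wy.
by exists (mk_arrow f); apply: orbit_arrow_eq.
Qed.

Variable F : functor C D.
Hypothesis FA : forall a, F \F A a = F.

Lemma arrow_map_orbit (m n : arrow C) :
  arrow_orbit A m n -> arrow_map F n = arrow_map F m.
Proof.
by move=> [a _ <-]; move/functor_eqP: (FA a) => /(congr1 (fun H => H m)).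
Qed.

Lemma orbit_inhabited (w : orbit_ob A) : exists x, sval w x.
Proof. by have [x ->] := svalP w; exists x; apply: orbit_self. Qed.

Definition orbit_lift_ob (w : orbit_ob A) : D :=
  F (sval (cid (orbit_inhabited w))).

Lemma orbit_lift_obE (w : orbit_ob A) (x : C) :
  sval w x -> F x = orbit_lift_ob w.
Proof.
rewrite /orbit_lift_ob; case: cid => y /= wy wx.
have [a <-] := orbit_trans wy wx.
exact: (congr1 (fun H : functor C D => H y) (FA a)).
Qed.

Lemma orbit_lift_hom_ex (w w' : orbit_ob A) (S : orbit_hom w w') :
  exists f : hom (orbit_lift_ob w) (orbit_lift_ob w'),
    forall m, sval S m -> arrow_map F m = mk_arrow f.
Proof.
have [[x [y f]] [/= wx wy eS]] := svalP S.
change (sval w x) in wx; change (sval w' y) in wy.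
suff [g eg] : exists g : hom (orbit_lift_ob w) (orbit_lift_ob w'),
    mk_arrow (fmap F f) = mk_arrow g.
  exists g => m; rewrite eS => /arrow_map_orbit ->; exact: eg.
(* The endpoints of [f] need not be the chosen representatives of [w] and [w']; generalizing its
   image frees the endpoints for rewriting. *)
move: (fmap F f); rewrite (orbit_lift_obE wx) (orbit_lift_obE wy).
by move=> g; exists g.
Qed.

Definition orbit_lift_hom (w w' : orbit_ob A) (S : orbit_hom w w') :
  hom (orbit_lift_ob w) (orbit_lift_ob w') := sval (cid (orbit_lift_hom_ex S)).

Lemma orbit_lift_homE (w w' : orbit_ob A) (S : orbit_hom w w') (m : arrow C) :
  sval S m -> arrow_map F m = mk_arrow (orbit_lift_hom S).
Proof. exact: (svalP (cid (orbit_lift_hom_ex S))). Qed.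

Fact orbit_lift1 (w : orbit_cat Afree) :
  orbit_lift_hom (idm w) = idm (orbit_lift_ob w).
Proof.
have [x wx] := orbit_inhabited w; apply: mk_arrow_inj.
rewrite -(orbit_lift_homE (m := mk_arrow (idm x))); last by exists x.
by rewrite /arrow_map /= fmap1 (orbit_lift_obE wx).
Qed.

Fact orbit_liftM (w1 w2 w3 : orbit_cat Afree) (T : hom w2 w3) (S : hom w1 w2) :
  orbit_lift_hom (T \c S) = orbit_lift_hom T \c orbit_lift_hom S.
Proof.
have [x [y [z [g [f [wx wy wz eT eS]]]]]] := orbit_comp_rep T S.
have Tg : sval T (mk_arrow g) by rewrite eT; apply: arrow_orbit_self.
have Sf : sval S (mk_arrow f) by rewrite eS; apply: arrow_orbit_self.
apply: mk_arrow_inj.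
rewrite -(orbit_lift_homE (m := mk_arrow (g \c f))); last first.
  by exists x, y, z, g, f.
have := orbit_lift_homE Tg; have := orbit_lift_homE Sf.
rewrite /arrow_map /= fmapM; move: (orbit_lift_hom T) (orbit_lift_hom S).
move: (fmap F g) (fmap F f).
rewrite (orbit_lift_obE wx) (orbit_lift_obE wy) (orbit_lift_obE wz).
by move=> g' f' g'' f'' /mk_arrow_inj -> /mk_arrow_inj ->.
Qed.

Definition orbit_lift : functor (orbit_cat Afree) D :=
  @Functor (orbit_cat Afree) D orbit_lift_ob orbit_lift_hom
    orbit_lift1 orbit_liftM.

Lemma orbit_lift_proj : orbit_lift \F orbit_proj Afree = F.
Proof.
apply: functor_eq => x y f; apply/esym/(orbit_lift_homE (m := mk_arrow f)).
exact: arrow_orbit_self.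
Qed.
End OrbitLift.

(** * Unique lifting along coverings *)

Definition star_arrow (C : category) (c : C) (m : star c) : arrow C :=
  match m with inl s => mk_arrow (projT2 s) | inr t => mk_arrow (projT2 t) end.

(** Both arrows lie in the star at the shared endpoint, where [F] is injective. *)
Lemma covering_arrow_inj (C B : category) (F : functor C B) (m n : arrow C) :
  is_covering F -> src m = src n \/ tgt m = tgt n ->
  arrow_map F m = arrow_map F n -> m = n.
Proof.
case: m n => x [y f] [x' [y' f']] [_ bijF]; rewrite /src /tgt /=.
case=> e; [subst x'|subst y'] => E.
  apply: (congr1 (@star_arrow C x) (x := inl (existT _ y f))
    (y := inl (existT _ y' f'))).
  by apply: (bij_inj (bijF x)); congr inl; exact: existT_inj E.
apply: (congr1 (@star_arrow C y) (x := inr (existT _ x f))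
  (y := inr (existT _ x' f'))).
(* Listing the target first lets [existT_inj] strip the common target. *)
pose swap (m : arrow B) : {b : B & {a : B & hom a b}} :=
  existT _ (tgt m) (existT _ (src m) (projT2 (projT2 m))).
by apply: (bij_inj (bijF y)); congr inr; exact: existT_inj (congr1 swap E).
Qed.

(** If [H] and [K] agree at one end of an arrow, its two images lift the same arrow from a common
    endpoint, hence coincide; connectedness spreads this from [e]. *)
Lemma covering_lift_unique (C B E : category) (F : functor C B)
    (H K : functor E C) (e : E) :
  is_covering F -> connected E -> F \F H = F \F K -> H e = K e -> H = K.
Proof.
move=> covF [_ conE] FHK eHK.
have stepE (x y : E) (f : hom x y) : H x = K x \/ H y = K y ->
    arrow_map H (mk_arrow f) = arrow_map K (mk_arrow f).
  move=> HKxy; apply: (covering_arrow_inj covF) => [//|].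
  by move/functor_eqP: FHK => /(congr1 (fun L => L (mk_arrow f))).
have obE (x y : E) (f : hom x y) : H x = K x <-> H y = K y.
  split=> e'; first by have /(congr1 (@tgt C)) := stepE _ _ f (or_introl e').
  by have /(congr1 (@src C)) := stepE _ _ f (or_intror e').
have HK (x : E) : H x = K x.
  (* An equivalence, unlike an implication, survives the symmetry case of the induction on
     zigzags. *)
  suff : H e = K e <-> H x = K x by move=> [] /(_ eHK).
  elim: (conE e x) => {x} [x y [f]|x|x y _ ih|x y z _ ihx _ ihy] //.
  - exact: obE f.
  - exact: iff_sym ih.
  - exact: iff_trans ihx ihy.
by apply: functor_eq => x y f; apply: stepE; left.
Qed.

(** * Connectedness and cancellation in groupoids *)

Lemma connected_groupoid_hom (G : groupoid) (x y : G) :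
  connected G -> inhabited (hom x y).
Proof.
case=> _ /(_ x y); elim=> {x y} // [x|x y _ [f]|x y z _ [f] _ [g]].
- by constructor; apply: idm.
- by constructor; apply: ginv f.
- by constructor; apply: compm g f.
Qed.

Lemma compmKV (G : groupoid) (x y z : G) (f : hom x y) (g : hom x z) :
  (g \c ginv f) \c f = g.
Proof. by rewrite -compmA compVm compm1. Qed.

Lemma compmVK (G : groupoid) (x y z : G) (f : hom x y) (g : hom y z) :
  (g \c f) \c ginv f = g.
Proof. by rewrite -compmA compmV compm1. Qed.

(** * The covering [F_X] and the quotient of the smash product *)

Section SmashQuotient.
Variables (B : category) (G : groupoid) (X : grading B G) (x0 : G).
Local Notation BX := (smash X x0).
Local Notation FX := (smash_proj X x0).
Local Notation A := (smash_action X x0).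
Local Notation Afree := (@smash_action_free B G X x0).
Hypothesis reach : forall b : B, inhabited (hom (X b) x0).

Lemma smash_proj_covering : is_covering FX.
Proof.
split=> [b|[b g]]; first by have [g] := reach b; exists (existT _ b g).
have srcP (y : B) (f : hom b y) :
    (g \c ginv (fmap X f)) \c fmap X f = g by apply: compmKV.
exists (fun m : star b => match m with
  | inl (existT y f) => inl (existT (fun t : BX => hom (existT _ b g : BX) t)
      (existT _ y (g \c ginv (fmap X f))) (exist _ f (srcP y f)))
  | inr (existT x f) => inr (existT (fun s : BX => hom s (existT _ b g : BX))
      (existT _ x (g \c fmap X f)) (exist _ f erefl))
  end).
- move=> [[[y d] [/= f Hf]]|[[x d] [/= f Hf]]] /=.
    have e : d = g \c ginv (fmap X f) by rewrite -Hf compmVK.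
    by subst d; do 2 congr (_ _); apply: sval_eq.
  by subst d.
- by move=> [[y f]|[x f]].
Qed.

Lemma smash_act_trans (s t : BX) :
  projT1 s = projT1 t -> exists a, A a s = t.
Proof.
case: s t => [b g] [c d] /= e; subst c.
exists (d \c ginv g); congr existT; exact: compmKV.
Qed.

(** For two arrows with the same image, some group element matches their targets; unique lifting
    with prescribed target then matches the arrows. *)
Lemma smash_arrow_orbit (m : arrow BX) :
  [set n | arrow_map FX n = arrow_map FX m] = arrow_orbit A m.
Proof.
apply/seteqP; split=> [n e|_ [a _ <-]//].
have [a ea] : exists a, A a (tgt m) = tgt n.
  by apply: smash_act_trans; apply: (congr1 (@tgt B) (esym e)).
exists a => //; apply: (covering_arrow_inj smash_proj_covering); first by right.
by rewrite e.
Qed.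

Lemma fibre_subproof (b : B) :
  exists s : BX, [set t : BX | projT1 t = b] = orbit_of A s.
Proof.
have [g] := reach b; exists (existT _ b g).
apply/seteqP; split=> [t /= e|_ [a _ <-]//].
by have [a <-] := smash_act_trans (s := existT _ b g) (esym e); exists a.
Qed.

Definition fibre_ob (b : B) : orbit_ob A := exist _ _ (fibre_subproof b).

Lemma fibre_arrow_subproof (b c : B) (f : hom b c) : exists m : arrow BX,
  [/\ sval (fibre_ob b) (src m), sval (fibre_ob c) (tgt m) &
    [set n | arrow_map FX n = mk_arrow f] = arrow_orbit A m].
Proof.
have [d] := reach c.
pose s : BX := existT _ b (d \c fmap X f); pose t : BX := existT _ c d.
exists (@mk_arrow BX s t (exist _ f erefl)); split=> //.
by rewrite -smash_arrow_orbit.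
Qed.

(* By unique lifting along the covering, the arrows over [f] form one orbit. *)
Definition fibre_hom (b c : B) (f : hom b c) :
  orbit_hom (fibre_ob b) (fibre_ob c) := exist _ _ (fibre_arrow_subproof f).

Fact fibre_hom1 (b : B) : fibre_hom (idm b) = Defs.orbit_id (fibre_ob b).
Proof.
apply: sval_eq; apply/seteqP; split=> [m e|_ [s /= <- ->]//].
have es : projT1 (src m) = b := congr1 (@src B) e.
exists (src m) => //=.
by apply: (covering_arrow_inj smash_proj_covering); [left|rewrite e -es].
Qed.

Fact fibre_homM (b c d : B) (g : hom c d) (f : hom b c) :
  fibre_hom (g \c f) = orbit_comp Afree (fibre_hom g) (fibre_hom f).
Proof.
apply: sval_eq; apply/seteqP; split=> [m e|]; last first.
  move=> _ [x [y [z [g' [f' [/= eg ef ->]]]]]].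
  case: x y z g' f' eg ef => [x gx] [y gy] [z gz] [/= g' Hg'] [/= f' Hf'] eg ef.
  rewrite /arrow_map /= in eg ef *.
  case: (eg) => ? ?; case: (ef) => ? _; subst.
  by rewrite (mk_arrow_inj ef) (mk_arrow_inj eg).
case: m e => [[b' gb] [[d' gd] [/= h Hh]]] e; rewrite /arrow_map /= in e.
case: (e) => ? ?; subst b' d'; move/mk_arrow_inj: e => e; subst h.
(* A lift of [g \c f] splits at this object: its label is forced by lifting [g] backwards from
   [(d, gd)]. *)
pose y : BX := existT _ c (gd \c fmap X g).
have Hf : projT2 y \c fmap X f = gb by rewrite -Hh fmapM compmA.
pose x : BX := existT _ b gb; pose z : BX := existT _ d gd.
pose f' : hom x y := exist _ f Hf; pose g' : hom y z := exist _ g erefl.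
exists x, y, z, g', f'.
by split=> //; congr mk_arrow; apply: sval_eq.
Qed.

Definition fibre : functor B (orbit_cat Afree) :=
  @Functor B (orbit_cat Afree) fibre_ob fibre_hom fibre_hom1 fibre_homM.

Lemma fibre_smash_proj : fibre \F FX = orbit_proj Afree.
Proof.
have eo (s : BX) : fibre_ob (projT1 s) = orbit_proj_ob A s.
  by apply: orbit_ob_eq.
apply: functor_eq => s t f.
apply: orbit_arrow_eq; [exact: eo|exact: eo|].
exact: (smash_arrow_orbit (mk_arrow f)).
Qed.

Lemma smash_proj_surj (n : arrow B) : exists m, arrow_map FX m = n.
Proof.
case: n => b [c f]; have [d] := reach c.
pose s : BX := existT _ b (d \c fmap X f).
by exists (@mk_arrow BX s (existT _ c d) (exist _ f erefl)).
Qed.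

Lemma smash_quotient : exists! Phi : functor (orbit_cat Afree) B,
  is_isomorphism Phi /\ Phi \F orbit_proj Afree = FX.
Proof.
have liftP := orbit_lift_proj Afree (smash_proj_act X (x0 := x0)).
set Phi := orbit_lift _ _ in liftP.
exists Phi; split=> [|Psi [_ e]]; last first.
  by apply: functor_epi (@orbit_proj_surj _ _ _ _) _; rewrite liftP e.
split=> //; exists fibre; split.
  apply: functor_epi (@orbit_proj_surj _ _ _ _) _.
  by rewrite -compFA liftP fibre_smash_proj comp1F.
apply: functor_epi smash_proj_surj _.
by rewrite -compFA fibre_smash_proj liftP comp1F.
Qed.
End SmashQuotient.

(** * Effective gradings: connectedness and deck transformations *)

Section Effective.
Variables (B : category) (G : groupoid) (X : grading B G) (x0 : G).
Hypothesis effX : effective X.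
Local Notation BX := (smash X x0).
Local Notation FX := (smash_proj X x0).

Lemma effective_reach (b : B) : inhabited (hom (X b) x0).
Proof. by case: effX => conG _ _; apply: connected_groupoid_hom. Qed.

Lemma smash_connected : connected BX.
Proof.
case: effX => conG [h _ _] fullX.
(* Surjectivity of [X] on objects enters only to supply an object of [B], hence one of the smash
   product. *)
have [g0] := connected_groupoid_hom (X (h x0)) x0 conG.
split; first by constructor; exists (h x0).
pose R := clos_refl_sym_trans BX (fun s t => inhabited (hom s t)).
(* A formal word is lifted backwards from [(c, d)]: generators give forward steps, formal inverses
   reversed ones. *)
have zigzag (b c : B) (p : zterm b c) (d : hom (X c) x0) :
    R (existT _ b (d \c zeval (fun _ _ f => ginvertible (fmap X f)) p))
      (existT _ c d).
  elim: p d => {b c} [b c f|b c f|b|a b c p ihp q ihq] d /=.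
  - by apply: rst_step; constructor; exists f.
  - apply: rst_sym; apply: rst_step; constructor; exists f.
    exact: compmKV.
  - by rewrite compm1; apply: rst_refl.
  - by rewrite compmA; apply: rst_trans (ihp d); apply: ihq.
move=> [b g] [c d].
(* With this choice the word lifted from [(c, d)] starts at label [d (d^-1 g) = g]. *)
have [q eq] := fullX b c (ginv d \c g).
have := zigzag _ _ (zrepr q) d; rewrite -[zeval _ _]/(fmap (Qgrading X) q) eq.
by rewrite compmA compmV comp1m.
Qed.

Lemma smash_proj_galois : is_galois_covering FX.
Proof.
split; [exact: (smash_proj_covering effective_reach)|exact: smash_connected|].
have [[[b g]] _] := smash_connected; exists b => s t es et.
have [a <-] : exists a, smash_action X x0 a s = t.
  by apply: smash_act_trans; rewrite -[LHS]/(FX s) es.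
by exists (deck X a).
Qed.

Lemma deckM : {morph @deck B G X x0 : a b / a * b}.
Proof. by move=> a b; apply: aut_eq; apply: actM. Qed.

(** Injectivity is freeness on objects. For surjectivity, [s] and [H s] share a fibre, so some deck
    transformation agrees with [H] at [s], hence everywhere by unique lifting. *)
Lemma deck_bij : bijective (@deck B G X x0).
Proof.
have [[s] _] := smash_connected.
apply: bijective_of_inj_surj => [a b /(congr1 (fun H : Aut FX => H s))|H].
  exact: (free_inj (@smash_action_free B G X x0)).
have [a ea] : exists a, smash_action X x0 a s = H s.
  apply: smash_act_trans.
  by rewrite -[RHS]/((FX \F H) s) aut_over.
exists a; apply: aut_eq.
apply: (covering_lift_unique (smash_proj_covering effective_reach)
  smash_connected _ ea).
by rewrite smash_proj_act aut_over.
Qed.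
End Effective.

(* The hypothesis of the first part, automatic if G is connected, is necessary:
   the smash product only sees the objects b such that X b lies in the connected
   component of x0. *)
Theorem proposition4p8 (B : category) (G : groupoid) (X : grading B G) (x0 : G) :
  ((forall b : B, inhabited (hom (X b) x0)) ->
   exists! Phi : functor (orbit_cat (@smash_action_free B G X x0)) B,
     is_isomorphism Phi /\
     Phi \F orbit_proj (@smash_action_free B G X x0) = smash_proj X x0) /\
  (effective X ->
   is_galois_covering (smash_proj X x0) /\
   {morph @deck B G X x0 : a b / a * b} /\
   bijective (@deck B G X x0)).
Proof.
split=> [reach|effX]; first exact: smash_quotient.
by split; [apply: smash_proj_galois|split; [apply: deckM|apply: deck_bij]].
Qed.
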